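(* Let $L$ be a Noether lattice. Let $0\neq q\in L$ be a non-nilpotent proper element satisfying the restricted cancellation law. Then $q$ is $\phi$-$\delta$-primary for some function $\phi:L\to L$ with $\phi\leqslant\phi_2$ if and only if $q$ is $\delta$-primary.
   Context: A multiplicative lattice is a complete lattice (least element $0$, greatest element $1$) with a commutative, associative multiplication that distributes over arbitrary joins and for which $1$ is the identity. For $a,b\in L$, $(a:b)=\bigvee\{x\in L\mid xb\leqslant a\}$. An element $e$ is meet principal if $a\wedge be=((a:e)\wedge b)e$ for all $a,b$, join principal if $(ae\vee b):e=(b:e)\vee a$ for all $a,b$, and principal if both. $L$ is principally generated if every element is a join of principal elements. A Noether lattice is a modular, principally generated multiplicative lattice satisfying the ascending chain condition. An element $a$ of a Noether lattice satisfies the restricted cancellation law if for all $b,c\in L$, $ab=ac\neq 0$ implies $b=c$. Standing assumptions: $L$ is also compactly generated (every element is a join of compact elements), $1$ is compact and every finite product of compact elements is compact; $\delta:L\to L$ is an expansion function, i.e. $a\leqslant\delta(a)$ for all $a$, and $a\leqslant b$ implies $\delta(a)\leqslant\delta(b)$. An element $p$ is proper if $p<1$; $q$ is non-nilpotent if $q^n\neq 0$ for all positive integers $n$. A proper element $p$ is $\delta$-primary if for all $a,b\in L$, $ab\leqslant p$ implies $a\leqslant p$ or $b\leqslant\delta(p)$. For $\phi:L\to L$, a proper element $p$ is $\phi$-$\delta$-primary if for all $a,b\in L$, $ab\leqslant p$ and $ab\not\leqslant\phi(p)$ implies $a\leqslant p$ or $b\leqslant\delta(p)$. $\phi_2(a)=a^2$,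 and $\gamma_1\leqslant\gamma_2$ for functions $L\to L$ means $\gamma_1(a)\leqslant\gamma_2(a)$ for all $a\in L$. *)

(* Defs.v *)
From HB Require Import structures.
From mathcomp Require Import all_boot all_order.
From mathcomp Require Import boolp classical_sets cardinality.
Set Implicit Arguments.
Unset Strict Implicit.
Unset Printing Implicit Defensive.
Import Order.LTheory.
Local Open Scope classical_set_scope.
Local Open Scope order_scope.

HB.mixin Record TBLattice_isComplete d (L : Type) of Order.TBLattice d L := {
  supremums_neq0 : forall A : set L, supremums A !=set0
}.

#[short(type="completeLatticeType")]
HB.structure Definition CompleteLattice d :=
  {L of Order.TBLattice d L & TBLattice_isComplete d L}.

(* The default value \bot of supremum is the join of the empty set; for a
   nonempty A, supremum picks the element of supremums A, which exists in a
   complete lattice. *)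
Definition bigjoin d (L : completeLatticeType d) (A : set L) : L :=
  supremum \bot A.

(* Associativity and the unit law come from the monoid structure, whose unit
   is identified with the greatest element by onelE.  Distributivity at
   A = set0 gives a * \bot = \bot. *)
HB.mixin Record CompleteLattice_isMultiplicative d (L : Type)
    of CompleteLattice d L & Monoid L := {
  mullC : commutative (@mul L);
  mul_bigjoinr : forall (a : L) (A : set L),
    (a * bigjoin A)%g = bigjoin [set (a * x)%g | x in A];
  onelE : 1%g = \top :> L
}.

#[short(type="multLatticeType")]
HB.structure Definition MultLattice d :=
  {L of CompleteLattice d L & Monoid L & CompleteLattice_isMultiplicative d L}.

Section MultLatticeTheory.
Context {d : Order.disp_t} {L : multLatticeType d}.
Implicit Types (a b c e p q x : L) (delta phi : L -> L).

Definition residual a b : L := bigjoin [set x | (x * b)%g <= a].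

Definition meet_principal e : Prop :=
  forall a b, a `&` (b * e)%g = ((residual a e `&` b) * e)%g.

Definition join_principal e : Prop :=
  forall a b, residual ((a * e)%g `|` b) e = residual b e `|` a.

Definition principal e : Prop := meet_principal e /\ join_principal e.

Definition compact_elt c : Prop :=
  forall A : set L, c <= bigjoin A ->
  exists B : set L, [/\ finite_set B, B `<=` A & c <= bigjoin B].

Definition restricted_cancellation a : Prop :=
  forall b c, (a * b)%g = (a * c)%g -> (a * b)%g <> \bot -> b = c.

Definition proper_elt p : Prop := p < \top.

Definition non_nilpotent q : Prop :=
  forall n : nat, (0 < n)%N -> (q ^+ n)%g <> \bot.

Definition expansion_function delta : Prop :=
  (forall a, a <= delta a) /\ (forall a b, a <= b -> delta a <= delta b).

Definition delta_primary delta p : Prop :=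
  proper_elt p /\
  forall a b, (a * b)%g <= p -> a <= p \/ b <= delta p.

Definition phi_delta_primary phi delta p : Prop :=
  proper_elt p /\
  forall a b, (a * b)%g <= p -> ~ (a * b)%g <= phi p ->
    a <= p \/ b <= delta p.

Definition phi2 a : L := (a ^+ 2)%g.

Definition le_fun (gamma1 gamma2 : L -> L) : Prop :=
  forall a, gamma1 a <= gamma2 a.

End MultLatticeTheory.

Section MultLatticeClasses.
Context {d : Order.disp_t} (L : multLatticeType d).

Definition modular_lattice : Prop :=
  forall a b c : L, a <= c -> a `|` (b `&` c) = (a `|` b) `&` c.

Definition principally_generated : Prop :=
  forall a : L, exists A : set L,
    (forall e, A e -> principal e) /\ a = bigjoin A.

Definition ascending_chain_condition : Prop :=
  forall u : nat -> L, (forall m n, (m <= n)%N -> u m <= u n) ->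
  exists N, forall n, (N <= n)%N -> u n = u N.

Definition noether_lattice : Prop :=
  [/\ modular_lattice, principally_generated & ascending_chain_condition].

Definition compactly_generated : Prop :=
  forall a : L, exists A : set L,
    (forall c, A c -> compact_elt c) /\ a = bigjoin A.

Definition compact_prod_closed : Prop :=
  forall s : seq L, (forall c, c \in s -> compact_elt c) ->
  compact_elt (\prod_(c <- s) c)%g.

End MultLatticeClasses.

(* Main.v *)
Require Import Defs.
From HB Require Import structures.
From mathcomp Require Import all_boot all_order.
From mathcomp Require Import boolp classical_sets cardinality.
Local Open Scope order_scope.
Import Order.LTheory.

(** For [phi <= phi2], being [phi]-[delta]-primary entails the
    [delta]-primary condition for the pairs [(a, b)] whose product lies
    below [q] but not below [q ^ 2].  A pair with [a * b <= q ^ 2] is handled by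
    moving it out of that exceptional region, replacing [b] by [b `|` q]: the
    product becomes [a * b `|` a * q], which still lies below [q].
    - If [a * q] is not below [q ^ 2], then neither is [a * (b `|` q)], and the
      condition for [(a, b `|` q)] gives the one for [(a, b)].
    - If [a * q <= q ^ 2], then [q * (a `|` q) = q * q], which is nonzero as [q]
      is not nilpotent; cancelling [q] gives [a `|` q = q], that is, [a <= q].
    The lattice-theoretic input is the distributivity of multiplication over
    binary joins ([mul_joinr]) and the fact that products lie below their
    factors ([mul_ler]).  Conversely, a [delta]-primary element is
    [phi]-[delta]-primary for every [phi]. *)

Lemma bigjoin2 (d : Order.disp_t) (L : completeLatticeType d) (b c : L) :
  bigjoin [set b; c]%classic = b `|` c.
Proof.
rewrite /bigjoin /supremum ifF; last first.
  by apply/negbTE/set0P; exists b; left.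
apply: xget_subset1; last exact: is_subset1_supremums.
split=> [y [->|->]|y yub]; [exact: leUl | exact: leUr |].
by rewrite leUx; apply/andP; split; apply: yub; [left | right].
Qed.

Section MultiplicationAndOrder.
Context {d : Order.disp_t} {L : multLatticeType d}.
Implicit Types (a b c : L).

Lemma mul_joinr a b c : (a * (b `|` c))%g = (a * b)%g `|` (a * c)%g.
Proof. by rewrite -!bigjoin2 mul_bigjoinr image_setU !image_set1. Qed.

(** Since [b <= 1] and multiplication by [a] preserves joins, [a * b <= a * 1]. *)
Lemma mul_ler a b : (a * b)%g <= a.
Proof.
by rewrite -[leRHS]mulg1 onelE -(joinx1 b) mul_joinr leUl.
Qed.

End MultiplicationAndOrder.

(** Cancelling [q] in [q * (a `|` q) = q * q]. *)
Lemma restricted_cancellation_le_sqr (d : Order.disp_t) (L : multLatticeType d)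
    (q a : L) :
  non_nilpotent q -> restricted_cancellation q -> (a * q)%g <= phi2 q -> a <= q.
Proof.
move=> q_nonnil q_rcl; rewrite /phi2 expg2 mullC => aq_le.
have qaq : (q * (a `|` q))%g = (q * q)%g by rewrite mul_joinr; apply: join_r.
rewrite -[leRHS](q_rcl _ _ qaq) ?leUl // qaq -expg2.
exact: q_nonnil.
Qed.

Theorem theorem2p18 (d : Order.disp_t) (L : multLatticeType d)
    (L_noether : noether_lattice L)
    (L_cgen : compactly_generated L)
    (top_compact : compact_elt (\top : L))
    (prod_compact : compact_prod_closed L)
    (delta : L -> L) (delta_exp : expansion_function delta)
    (q : L) (q_neq0 : q <> \bot) (q_nonnil : non_nilpotent q)
    (q_proper : proper_elt q) (q_rcl : restricted_cancellation q) :
  (exists phi : L -> L, le_fun phi phi2 /\ phi_delta_primary phi delta q) <->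
  delta_primary delta q.
Proof.
split=> [[phi [phi_le [_ q_prim]]] | [_ q_prim]]; last first.
  exists phi2; split=> [a|]; first exact: lexx.
  by split=> // a b ab_le _; exact: q_prim.
have off_sqr a b : (a * b)%g <= q -> ~ (a * b)%g <= phi2 q ->
    a <= q \/ b <= delta q.
  by move=> ab_le ab_nle; apply: q_prim => // /le_trans /(_ (phi_le q)).
split=> // a b ab_le.
have [aq_le|aq_nle] := pselect ((a * q)%g <= phi2 q).
  by left; exact: restricted_cancellation_le_sqr aq_le.
have [||a_le|] := off_sqr a (b `|` q).
- by rewrite mul_joinr leUx ab_le mullC mul_ler.
- by rewrite mul_joinr leUx => /andP[_ /aq_nle].
- by left.
- by rewrite leUx => /andP[b_le _]; right.
Qed.
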